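(* Let $r\in\{3,4,\ldots\}$ and let $\rho_1,\ldots,\rho_r$ be quantum states on a common space. Then $$F^\flat_{2,r}\ \ge\ F^\flat_{3,r}\ \ge\ \cdots\ \ge\ F^\flat_{r-1,r}\ \ge\ F^\flat_{r,r},$$ where $F^\flat_{k,r}=F^\flat_{k,r}(\rho_1,\ldots,\rho_r)$ is the average $k$-wise log-Euclidean fidelity.
   Context: A quantum state is a positive semi-definite operator of unit trace on a finite-dimensional complex Hilbert space. For positive definite operators $F^\flat_k(\rho_1,\ldots,\rho_k)=\operatorname{Tr}\big[\exp\big(\frac1k\sum_{i=1}^k\ln\rho_i\big)\big]$; for general states $F^\flat_k(\rho_1,\ldots,\rho_k)=\inf_{\varepsilon>0}F^\flat_k(\rho_1+\varepsilon I,\ldots,\rho_k+\varepsilon I)=\lim_{\varepsilon\to0^+}F^\flat_k(\rho_1+\varepsilon I,\ldots,\rho_k+\varepsilon I)$. For $k\in\{2,\ldots,r\}$, the average $k$-wise log-Euclidean fidelity is $F^\flat_{k,r}(\rho_1,\ldots,\rho_r)=\binom rk^{-1}\sum_{1\le i_1<\cdots<i_k\le r}F^\flat_k(\rho_{i_1},\ldots,\rho_{i_k})$. *)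

(* Defs.v *)
From HB Require Import structures.
From mathcomp Require Import all_boot all_order all_algebra.
From mathcomp Require Import spectral sesquilinear.
From mathcomp Require Import complex.
From mathcomp Require Import all_classical all_reals all_analysis.

Set Implicit Arguments.
Unset Strict Implicit.
Unset Printing Implicit Defensive.
Import Order.TTheory GRing.Theory Num.Theory.

Local Open Scope ring_scope.
Local Open Scope classical_set_scope.
Local Open Scope complex_scope.
Local Open Scope sesquilinear_scope.

Section LogEuclideanFidelity.
Variables (R : realType) (d : nat).
Implicit Types (A : 'M[R[i]]_d) (f : R -> R).

Definition psdmx A : Prop :=
  A \is hermsymmx /\ forall v : 'cV[R[i]]_d, 0 <= (v ^t* *m A *m v) 0 0.

Definition quantum_state A : Prop := psdmx A /\ \tr A = 1.

(* Functional calculus: f acts on the eigenvalues of a Hermitian matrix, which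
   are real. The result does not depend on the choice of the eigenbasis made
   by [spectralmx]; see [herm_funE]. *)
Definition herm_fun f A : 'M[R[i]]_d :=
  invmx (spectralmx A)
    *m diag_mx (map_mx (fun z => (f (complex.Re z))%:C) (spectral_diag A))
    *m spectralmx A.

Lemma herm_funE f (U : 'M[R[i]]_d) (e : 'rV[R]_d) : U \is unitarymx ->
  herm_fun f (U ^t* *m diag_mx (map_mx (real_complex R) e) *m U) =
  U ^t* *m diag_mx (map_mx (fun x => (f x)%:C) e) *m U.
Proof.
move=> Uu; set A := (X in herm_fun f X).
have An : A \is normalmx.
  apply/orthomx_spectral_subproof; exists (U, map_mx (real_complex R) e) => //=.
  by rewrite /A invmx_unitary.
rewrite /herm_fun; have := orthomx_spectralP An.
have Vu := spectral_unitarymx A.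
rewrite (invmx_unitary Vu); move: (spectralmx A) (spectral_diag A) Vu => V D Vu.
move=> AE; pose W := V *m U ^t*.
have UtU : U ^t* *m U = 1%:M.
  by rewrite -(invmx_unitary Uu) mulVmx // unitarymx_unit.
have VtV : V ^t* *m V = 1%:M.
  by rewrite -(invmx_unitary Vu) mulVmx // unitarymx_unit.
have WE :
    diag_mx D *m W = W *m diag_mx (map_mx (real_complex R) e).
  have /(congr1 (fun M => V *m M *m U ^t*)) /= := AE.
  rewrite /A !mulmxA (unitarymxP Vu) mul1mx => <-.
  by rewrite /W -mulmxA (unitarymxP Uu) mulmx1.
have WfE : diag_mx (map_mx (fun z => (f (complex.Re z))%:C) D) *m W =
    W *m diag_mx (map_mx (fun x => (f x)%:C) e).
  move: (W) WE => {}W /matrixP WE; apply/matrixP => i j; have := WE i j.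
  rewrite !mul_diag_mx !mul_mx_diag !mxE.
  have [->|W0] := eqVneq (W i j) 0; first by rewrite !mulr0 !mul0r.
  by rewrite [RHS]mulrC => /(mulIf W0) ->; rewrite mulrC.
have VW : V ^t* *m W = U ^t* by rewrite /W mulmxA VtV mul1mx.
have {2}-> : V = W *m U by rewrite /W -mulmxA UtU mulmx1.
by rewrite -VW -[LHS]mulmxA [in LHS](mulmxA (diag_mx _) W) WfE -!mulmxA.
Qed.

Definition expmx A := herm_fun (@expR R) A.
Definition lnmx A := herm_fun (@ln R) A.

(* The trace below is that of a Hermitian matrix; [complex.Re] only serves to
   read it as an element of R. *)
Definition logEuclid_pd k (rho : 'I_k -> 'M[R[i]]_d) : R :=
  complex.Re (\tr (expmx (k%:R^-1 *: \sum_(j < k) lnmx (rho j)))).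

Definition logEuclid k (rho : 'I_k -> 'M[R[i]]_d) : R :=
  inf [set logEuclid_pd (fun j => rho j + (eps%:C)%:M) | eps in [set x : R | 0 < x]].

(* The sum ranges over the strictly increasing k-tuples of indices. *)
Definition avg_logEuclid r (rho : 'I_r -> 'M[R[i]]_d) (k : nat) : R :=
  'C(r, k)%:R^-1 *
  \sum_(t : k.-tuple 'I_r | sorted ltn (map val t))
    logEuclid (fun j : 'I_k => rho (tnth t j)).

End LogEuclideanFidelity.

(* Main.v *)
(** Put H_j(e) = ln (rho_j + e I). The mean of H_j(e) over a (k+1)-set S is the
    mean over i in S of the means of H_j(e) over S \ i, so convexity of
    A |-> Tr exp A bounds the fidelity of S by the mean of the fidelities of the
    sets S \ i, and averaging over all S gives the theorem. Since the infima over
    e are approached at different e for different i, this is combined with the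
    monotonicity of H_j in e. Convexity and monotonicity of Tr exp both follow
    from Klein's inequality Tr exp B >= Tr (exp A (1 + B - A)), applied with A
    the mean over S and B the mean over S \ i; in an eigenbasis of A it only
    involves the diagonal entries of B. *)
Require Import Defs.
From mathcomp Require Import all_boot all_order all_algebra.
From mathcomp Require Import spectral sesquilinear.
From mathcomp Require Import complex.
From mathcomp Require Import all_classical all_reals all_analysis.
From mathcomp Require Import ring.

Set Implicit Arguments.
Unset Strict Implicit.
Unset Printing Implicit Defensive.
Import Order.TTheory GRing.Theory Num.Theory.
Local Open Scope ring_scope.
Local Open Scope complex_scope.
Local Open Scope sesquilinear_scope.

(** * Squared moduli and real parts of complex numbers *)

Definition abs_sq {R : realType} (z : R[i]) : R :=
  complex.Re z ^+ 2 + complex.Im z ^+ 2.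

Lemma abs_sq_ge0 (R : realType) (z : R[i]) : 0 <= abs_sq z.
Proof. by rewrite addr_ge0 ?sqr_ge0. Qed.

Lemma abs_sqE (R : realType) (z : R[i]) : z * Num.conj z = (abs_sq z)%:C.
Proof. by rewrite -normCK /abs_sq add_Re2_Im2. Qed.

Lemma ReM_real_complex (R : realType) (x : R) (z : R[i]) :
  complex.Re (x%:C * z) = x * complex.Re z.
Proof. by case: z => a b /=; rewrite mul0r subr0. Qed.

Lemma Re_sum (R : realType) (I : Type) (s : seq I) (P : pred I) (F : I -> R[i]) :
  complex.Re (\sum_(i <- s | P i) F i) = \sum_(i <- s | P i) complex.Re (F i).
Proof. by apply: (big_morph (@complex.Re R)) => // -[a b] [c e]. Qed.

(** * Klein's inequality *)

Section UnitaryDiagonal.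
Variables (R : realType) (d : nat).
Implicit Types (A B M U V W : 'M[R[i]]_d) (a b : 'rV[R]_d).

(** The shape matches [herm_funE] and the eigenvalues are real by type, so a functional calculus
    acts on [a] directly, whatever eigenbasis was chosen. *)
Definition unitary_diag U a : 'M[R[i]]_d :=
  U ^t* *m diag_mx (map_mx (real_complex R) a) *m U.

(** This is the quadratic form of [M] at the p-th column of [U ^t*]. It is linear in [M], which
    reduces means and comparisons of matrices to real numbers. *)
Definition diag_entry U M p : R := complex.Re ((U *m M *m U ^t*) p p).

Lemma diag_entry_unitary_diag U V b p :
  diag_entry U (unitary_diag V b) p =
  \sum_m abs_sq ((U *m V ^t*) p m) * b 0 m.
Proof.
rewrite /diag_entry /unitary_diag.
set W := U *m V ^t*.
have -> : U *m (V ^t* *m diag_mx (map_mx (real_complex R) b) *m V) *m U ^t* =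
    W *m diag_mx (map_mx (real_complex R) b) *m W ^t*.
  by rewrite /W trmx_mul map_mxM trmxCK !mulmxA.
rewrite mxE Re_sum; apply: eq_bigr => m _.
by rewrite mul_mx_diag !mxE mulrAC abs_sqE ReM_real_complex.
Qed.

Lemma unitary_row_abs_sq W p : W \is unitarymx -> \sum_m abs_sq (W p m) = 1.
Proof.
move=> /unitarymxP /matrixP /(_ p p); rewrite !mxE eqxx => /(congr1 (@complex.Re R)).
rewrite Re_sum /= => <-; apply: eq_bigr => m _.
by rewrite !mxE abs_sqE.
Qed.

Lemma unitary_col_abs_sq W m : W \is unitarymx -> \sum_p abs_sq (W p m) = 1.
Proof.
rewrite -trmxC_unitary => /(@unitary_row_abs_sq _ m) <-; apply: eq_bigr => p _.
by rewrite !mxE /abs_sq; case: (W p m) => x y /=; rewrite sqrrN.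
Qed.

Lemma diag_entryE U a p : U \is unitarymx ->
  diag_entry U (unitary_diag U a) p = a 0 p.
Proof.
move=> /unitarymxP UU; rewrite diag_entry_unitary_diag UU (bigD1 p) //= big1.
  by rewrite mxE eqxx /abs_sq /= expr1n expr0n !(addr0,mul1r).
by move=> m mp; rewrite mxE eq_sym (negbTE mp) /abs_sq /= expr0n addr0 mul0r.
Qed.

(* The tangent-line bound [e^a (1 + b - a) <= e^b] is averaged with the
   doubly stochastic weights [abs_sq ((U *m V ^t* ) p m)]. *)
Lemma trace_klein U V a b : U \is unitarymx -> V \is unitarymx ->
  \sum_p expR (a 0 p) * (1 + (diag_entry U (unitary_diag V b) p - a 0 p)) <=
  \sum_m expR (b 0 m).
Proof.
move=> Uu Vu; pose W := U *m V ^t*.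
have Wu : W \is unitarymx by apply: (mul_unitarymx Uu); rewrite trmxC_unitary.
(* The columns of weights sum to 1, so the right-hand side becomes a double sum. *)
have -> : \sum_m expR (b 0 m) =
    \sum_p \sum_m abs_sq (W p m) * expR (b 0 m).
  rewrite exchange_big; apply: eq_bigr => m _.
  by rewrite -mulr_suml unitary_col_abs_sq // mul1r.
apply: ler_sum => p _; rewrite diag_entry_unitary_diag -/W.
(* The rows of weights sum to 1, so the constants move under the average and the bound can be
   checked term by term. *)
have -> : 1 + (\sum_m abs_sq (W p m) * b 0 m - a 0 p) =
    \sum_m abs_sq (W p m) * (1 + (b 0 m - a 0 p)).
  under [RHS]eq_bigr do rewrite mulrDr mulrBr mulr1.
  by rewrite big_split sumrB /= -mulr_suml unitary_row_abs_sq // mul1r.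
rewrite mulr_sumr; apply: ler_sum => m _.
rewrite mulrCA ler_wpM2l ?abs_sq_ge0 //.
have -> : b 0 m = a 0 p + (b 0 m - a 0 p) by rewrite addrC subrK.
by rewrite expRD [a 0 p + _]addrC addrK ler_wpM2l ?expR_ge0 // expR_ge1Dx.
Qed.

(** * Spectral form of Hermitian matrices and the trace of the exponential *)

Lemma hermitian_unitary_diag A : A \is hermsymmx ->
  exists2 U, U \is unitarymx & exists a, A = unitary_diag U a.
Proof.
move=> Ah; have Uu := spectral_unitarymx A.
exists (spectralmx A) => //; exists (map_mx (@complex.Re R) (spectral_diag A)).
rewrite /unitary_diag -map_mx_comp -(invmx_unitary Uu).
have /mxOverP rD := hermitian_spectral_diag_real Ah.
have -> : map_mx (real_complex R \o @complex.Re R) (spectral_diag A) = spectral_diag A.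
  by apply/matrixP => i j; rewrite mxE /= RRe_real.
exact/orthomx_spectralP/hermitian_normalmx.
Qed.

Lemma unitary_diag_hermitian U a : unitary_diag U a \is hermsymmx.
Proof.
apply/is_hermitianmxP; rewrite scale1r /unitary_diag.
rewrite !trmx_mul !map_mxM trmxCK mulmxA tr_diag_mx map_diag_mx.
congr (_ *m diag_mx _ *m _).
by apply/matrixP => i j; rewrite !mxE /= conj_Creal // complex_real.
Qed.

Lemma herm_fun_unitary_diag f U a : U \is unitarymx ->
  herm_fun f (unitary_diag U a) = unitary_diag U (map_mx f a).
Proof. by move=> Uu; rewrite /unitary_diag (herm_funE _ _ Uu) -map_mx_comp. Qed.

Definition tr_exp A : R := complex.Re (\tr (expmx A)).

Lemma tr_exp_unitary_diag U a : U \is unitarymx ->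
  tr_exp (unitary_diag U a) = \sum_p expR (a 0 p).
Proof.
move=> Uu; rewrite /tr_exp /expmx (herm_fun_unitary_diag _ _ Uu).
rewrite mxtrace_mulC mulmxA (unitarymxP Uu) mul1mx mxtrace_diag Re_sum.
by apply: eq_bigr => p _; rewrite !mxE.
Qed.

Lemma tr_exp_ge0 A : A \is hermsymmx -> 0 <= tr_exp A.
Proof.
move=> /hermitian_unitary_diag [U Uu [a ->]].
by rewrite tr_exp_unitary_diag // sumr_ge0 // => p _; rewrite expR_ge0.
Qed.

(** Jensen's inequality and monotonicity in one: the last hypothesis says that [A] lies below the
    mean of the [B i] as a quadratic form. Klein's inequality is applied to each [B i] in one fixed
    eigenbasis of [A], and the bounds are averaged. *)
Lemma le_tr_exp_mean (I : finType) (S : {set I}) A (B : I -> 'M[R[i]]_d) :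
  (0 < #|S|)%N -> A \is hermsymmx -> (forall i, B i \is hermsymmx) ->
  (forall U p, diag_entry U A p <= #|S|%:R^-1 * \sum_(i in S) diag_entry U (B i) p) ->
  tr_exp A <= #|S|%:R^-1 * \sum_(i in S) tr_exp (B i).
Proof.
move=> S0 /hermitian_unitary_diag [U Uu [a ->]] Bh AB.
have nS : #|S|%:R != 0 :> R by rewrite pnatr_eq0 -lt0n.
rewrite tr_exp_unitary_diag //.
have K i : \sum_p expR (a 0 p) * (1 + (diag_entry U (B i) p - a 0 p)) <= tr_exp (B i).
  have [V Vu [b ->]] := hermitian_unitary_diag (Bh i).
  by rewrite (tr_exp_unitary_diag _ Vu); exact: trace_klein Uu Vu.
have : #|S|%:R^-1 * \sum_(i in S)
      \sum_p expR (a 0 p) * (1 + (diag_entry U (B i) p - a 0 p)) <=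
  #|S|%:R^-1 * \sum_(i in S) tr_exp (B i).
  by rewrite ler_wpM2l ?invr_ge0 ?ler0n // ler_sum.
apply: le_trans; rewrite exchange_big mulr_sumr; apply: ler_sum => p _ /=.
(* It remains to see that the averaged factor multiplying [expR (a 0 p)] is at least 1, which is the
   hypothesis at the eigenvector p. *)
rewrite -mulr_sumr mulrCA ler_peMr ?expR_ge0 //.
rewrite big_split sumrB /= !sumr_const -[a 0 p *+ _]mulr_natl.
rewrite mulrDr mulrBr mulVf // mulKf //.
by rewrite lerDl subr_ge0 -{1}(diag_entryE a p Uu).
Qed.

(** A single eigenbasis serves all shifts [e], so logarithms taken at different shifts can be
    compared eigenvalue by eigenvalue. *)
Lemma psd_shift_unitary_diag A : psdmx A ->
  exists2 U, U \is unitarymx & exists2 a : 'rV[R]_d, (forall p, 0 <= a 0 p) &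
  forall e : R, A + (e%:C)%:M = unitary_diag U (map_mx (+%R e) a).
Proof.
move=> [/hermitian_unitary_diag [U Uu [a ->]] Apsd]; exists U => //; exists a.
  move=> p; rewrite -(diag_entryE a p Uu) /diag_entry.
  (* The test vector is the eigenvector with eigenvalue [a 0 p]. *)
  have := Apsd (U ^t* *m delta_mx p 0).
  have -> : (U ^t* *m delta_mx p 0) ^t* *m unitary_diag U a *m (U ^t* *m delta_mx p 0) =
      delta_mx (0 : 'I_1) p *m (U *m unitary_diag U a *m U ^t*) *m delta_mx p (0 : 'I_1).
    by rewrite trmx_mul map_mxM trmxCK trmx_delta map_delta_mx !mulmxA.
  move: (U *m _ *m U ^t*) => M.
  by rewrite lecE => /andP[_]; rewrite -rowE -colE !mxE.
move=> e; rewrite /unitary_diag.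
have -> : map_mx (real_complex R) (map_mx (+%R e) a) =
    const_mx e%:C + map_mx (real_complex R) a.
  by apply/matrixP => i j; rewrite !mxE rmorphD.
rewrite raddfD /= diag_const_mx mulmxDr mulmxDl addrC; congr (_ + _).
rewrite mul_mx_scalar -scalemxAl -(invmx_unitary Uu).
by rewrite mulVmx ?unitarymx_unit // scalemx1.
Qed.

Lemma lnmx_psd_shift_hermitian A e : psdmx A -> lnmx (A + (e%:C)%:M) \is hermsymmx.
Proof.
move=> /psd_shift_unitary_diag [U Uu [a _ ->]].
rewrite /lnmx (herm_fun_unitary_diag _ _ Uu).
exact: unitary_diag_hermitian.
Qed.

(** In the common eigenbasis the two entries are averages with the same nonnegative weights, so
    scalar monotonicity of [ln] on positive numbers suffices. *)
Lemma diag_entry_lnmx_shift A e e' U p : psdmx A -> 0 < e -> e <= e' ->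
  diag_entry U (lnmx (A + (e%:C)%:M)) p <= diag_entry U (lnmx (A + (e'%:C)%:M)) p.
Proof.
move=> /psd_shift_unitary_diag [V Vu [a a0 AE]] e0 ee'.
have lnE x : lnmx (A + (x%:C)%:M) = unitary_diag V (map_mx (@ln R) (map_mx (+%R x) a)).
  by rewrite AE /lnmx (herm_fun_unitary_diag _ _ Vu).
rewrite 2!lnE 2!diag_entry_unitary_diag; apply: ler_sum => m _.
rewrite ler_wpM2l ?abs_sq_ge0 // !mxE ler_ln ?posrE ?lerD2r //.
  by rewrite ltr_wpDr.
by rewrite ltr_wpDr // (lt_le_trans e0).
Qed.

Lemma diag_entry_scale_sum (I : finType) (S : pred I) (k : nat)
    (F : I -> 'M[R[i]]_d) U p :
  diag_entry U (k%:R^-1 *: \sum_(i | S i) F i) p =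
  k%:R^-1 * \sum_(i | S i) diag_entry U (F i) p.
Proof.
rewrite /diag_entry -scalemxAr -scalemxAl mxE mulmx_sumr mulmx_suml summxE.
have -> : (k%:R^-1 : R[i]) = (k%:R^-1)%:C by rewrite fmorphV rmorph_nat.
by rewrite ReM_real_complex Re_sum.
Qed.

Lemma scale_sum_hermitian (I : finType) (S : pred I) (k : nat) (F : I -> 'M[R[i]]_d) :
  (forall i, F i \is hermsymmx) -> k%:R^-1 *: \sum_(i | S i) F i \is hermsymmx.
Proof.
move=> Fh; apply/is_hermitianmxP; rewrite scale1r linearZ /= map_mxZ.
rewrite fmorphV rmorph_nat; congr (_ *: _).
rewrite raddf_sum raddf_sum; apply: eq_bigr => i _.
by have /is_hermitianmxP := Fh i; rewrite scale1r.
Qed.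

End UnitaryDiagonal.

(** * Fidelities indexed by sets *)

Section SetFidelity.
Variables (R : realType) (d r : nat) (rho : 'I_r -> 'M[R[i]]_d).
Hypothesis rho_psd : forall j, psdmx (rho j).
Implicit Types (S T : {set 'I_r}) (e : R).

Definition log_mean S e : 'M[R[i]]_d :=
  #|S|%:R^-1 *: \sum_(j in S) lnmx (rho j + (e%:C)%:M).

(** The fidelity is symmetric in its arguments, so it can be indexed by sets, where deleting an
    index is simply [S :\ i]. *)
Definition set_logEuclid S : R :=
  inf [set tr_exp (log_mean S e) | e in [set x : R | 0 < x]]%classic.

Lemma log_mean_hermitian S e : log_mean S e \is hermsymmx.
Proof. by apply: scale_sum_hermitian => j; exact: lnmx_psd_shift_hermitian. Qed.

Lemma diag_entry_log_mean U S e p :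
  diag_entry U (log_mean S e) p =
  #|S|%:R^-1 * \sum_(j in S) diag_entry U (lnmx (rho j + (e%:C)%:M)) p.
Proof. exact: diag_entry_scale_sum. Qed.

Lemma set_logEuclid_le S e : 0 < e -> set_logEuclid S <= tr_exp (log_mean S e).
Proof.
move=> e0; apply: ge_inf; last by exists e.
by exists 0 => _ [x _ <-]; exact/tr_exp_ge0/log_mean_hermitian.
Qed.

Lemma set_logEuclid_adherent S delta : 0 < delta ->
  exists2 e, 0 < e & tr_exp (log_mean S e) < set_logEuclid S + delta.
Proof.
move=> d0.
have hinf : has_inf [set tr_exp (log_mean S e) | e in [set x : R | 0 < x]]%classic.
  split; first by exists (tr_exp (log_mean S 1)), 1 => //=; rewrite ltr01.
  by exists 0 => _ [x _ <-]; exact/tr_exp_ge0/log_mean_hermitian.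
by have [_ [e e0 <-] lt_e] := inf_adherent d0 hinf; exists e.
Qed.

(** The shifts [eps i] may differ: lowering them all to [e] only decreases the logarithms, and at a
    common shift the mean over [S] is exactly the mean of the means over [S :\ i]. *)
Lemma le_tr_exp_log_mean S (eps : 'I_r -> R) e : (1 < #|S|)%N -> 0 < e ->
  (forall i, e <= eps i) ->
  tr_exp (log_mean S e) <=
  #|S|%:R^-1 * \sum_(i in S) tr_exp (log_mean (S :\ i) (eps i)).
Proof.
move=> S1 e0 eeps.
apply: (@le_tr_exp_mean _ _ _ S (log_mean S e)
    (fun i => log_mean (S :\ i) (eps i))) => [|||U p].
- exact: ltnW.
- exact: log_mean_hermitian.
- by move=> i; exact: log_mean_hermitian.
rewrite [leLHS]diag_entry_log_mean; apply: ler_wpM2l; first by rewrite invr_ge0 ler0n.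
pose q i x := diag_entry U (lnmx (rho i + (x%:C)%:M)) p.
have nS : (#|S|.-1)%:R != 0 :> R by rewrite pnatr_eq0; case: #|S| S1 => [|[]].
have cS i : i \in S -> #|S :\ i| = #|S|.-1 by move=> iS; rewrite (cardsD1 i S) iS.
have -> : \sum_(i in S) diag_entry U (lnmx (rho i + (e%:C)%:M)) p =
    \sum_(i in S) (#|S|.-1)%:R^-1 * \sum_(j in S :\ i) q j e.
  (* Double counting: each [j] in [S] belongs to [S :\ i] for exactly [#|S|.-1] indices [i] of
     [S]. *)
  rewrite -mulr_sumr (exchange_big_dep (mem S)) /= => [|i j _]; last first.
    by rewrite inE => /andP[].
  rewrite mulr_sumr; apply: eq_bigr => j jS.
  under eq_bigl do rewrite 2!inE jS andbT eq_sym andbC.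
  rewrite sumr_const -(cS j jS) -(mulr_natl (q j e)).
  have -> : #|[pred i | (i != j) && (i \in S)]| = #|S :\ j|.
    by apply: eq_card => i; rewrite !inE.
  by rewrite cS // mulKf.
apply: ler_sum => i iS; rewrite diag_entry_log_mean (cS i iS).
apply: ler_wpM2l; first by rewrite invr_ge0 ler0n.
by apply: ler_sum => j _; exact: diag_entry_lnmx_shift.
Qed.

Lemma set_logEuclid_le_mean S : (1 < #|S|)%N ->
  set_logEuclid S <= #|S|%:R^-1 * \sum_(i in S) set_logEuclid (S :\ i).
Proof.
move=> S1; apply/ler_addgt0Pr => delta d0.
have /choice[eps eps_adh] i : exists e, 0 < e /\
    tr_exp (log_mean (S :\ i) e) < set_logEuclid (S :\ i) + delta.
  by have [e] := set_logEuclid_adherent (S :\ i) d0; exists e.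
(* A finite minimum of positive shifts stays positive; 1 is only the starting value. *)
pose e := \big[Num.min/1]_i eps i.
have e0 : 0 < e by apply: lt_bigmin => // i _; have [] := eps_adh i.
have ee i : e <= eps i by exact: bigmin_le.
apply: le_trans (set_logEuclid_le S e0) _.
apply: le_trans (le_tr_exp_log_mean S1 e0 ee) _.
have nS : #|S|%:R != 0 :> R by rewrite pnatr_eq0; case: #|S| S1.
(* The error is spread evenly over [S], to be absorbed by the slack of each [eps i]. *)
have -> : delta = #|S|%:R^-1 * \sum_(i in S) delta.
  by rewrite sumr_const -(mulr_natl delta) mulKf.
rewrite -mulrDr -big_split /= ler_wpM2l ?invr_ge0 ?ler0n //.
by apply: ler_sum => i _; rewrite ltW //; have [] := eps_adh i.
Qed.

End SetFidelity.

(** * Averaging over sets *)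

Lemma sorted_tuple_uniq r k (t : k.-tuple 'I_r) : sorted ltn (map val t) -> uniq t.
Proof.
by move=> st; rewrite -(map_inj_uniq val_inj); exact: sorted_uniq ltn_trans ltnn _ st.
Qed.

(** A k-set and its increasing enumeration determine each other. The cases k = 0 and r = 0 are split
    off so that [ord0] can serve as default for [nth]. *)
Lemma sum_sorted_tuples (V : nmodType) r k (G : {set 'I_r} -> V) :
  \sum_(t : k.-tuple 'I_r | sorted ltn (map val t)) G [set x in t] =
  \sum_(S : {set 'I_r} | #|S| == k) G S.
Proof.
case: k => [|k].
  rewrite (big_pred1 [tuple]) => [|t]; last by rewrite [t]tuple0.
  rewrite (big_pred1 finset.set0) => [|S]; last by rewrite cards_eq0.
  by congr G; apply/setP => x; rewrite !inE.
case: r G => [|r] G.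
  rewrite [RHS]big1 => [|S]; last by rewrite eq_card0 // => -[].
  by rewrite big1 // => -[[|[]]].
pose f_t (t : k.+1.-tuple 'I_r.+1) := [set i in t]%SET.
pose f_S (S : {set 'I_r.+1}) := [tuple of mkseq (nth ord0 (enum S)) k.+1].
have val_fS (S : {set 'I_r.+1}) : #|S| = k.+1 -> val (f_S S) = enum S.
  by move=> Sk; rewrite -[enum _](mkseq_nth ord0) -cardE Sk.
have inc_S (S : {set 'I_r.+1}) : sorted ltn (map val (enum S)).
  apply: (subseq_sorted ltn_trans (s2 := map val (enum 'I_r.+1))).
    by rewrite map_subseq // [X in subseq _ X]enumT /enum_mem filter_subseq.
  by rewrite val_enum_ord iota_ltn_sorted.
rewrite [RHS](reindex_onto f_t f_S) => [|S /eqP Sk]; last first.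
  by apply/setP=> x; rewrite inE -(mem_enum S) -(val_fS S Sk).
apply: eq_bigl => t; apply/idP/andP => [st|[/eqP tk /eqP <-]]; last by rewrite val_fS.
have tk : #|f_t t| = k.+1.
  by rewrite cardsE (card_uniqP _) ?size_tuple // sorted_tuple_uniq.
rewrite tk eqxx -val_eqE val_fS // -(inj_eq (inj_map val_inj)); split => //.
(* Two strictly increasing sequences with the same elements are equal. *)
apply/eqP/(irr_sorted_eq ltn_trans ltnn) => // y.
by apply/mapP/mapP=> [] [x t_x ->]; exists x; rewrite // mem_enum inE in t_x *.
Qed.

(** A k-set [T] arises as [S :\ i] once for each of the r - k indices [i] outside [T], namely from
    [S = i |: T]. *)
Lemma sum_set_remove (V : nmodType) r k (G : {set 'I_r} -> V) :
  \sum_(S : {set 'I_r} | #|S| == k.+1) \sum_(i in S) G (S :\ i)%SET =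
  (\sum_(T : {set 'I_r} | #|T| == k) G T) *+ (r - k).
Proof.
rewrite (exchange_big_dep predT) //=.
transitivity (\sum_(i < r) \sum_(T : {set 'I_r} | (#|T| == k) && (i \notin T)) G T).
  apply: eq_bigr => i _.
  rewrite (reindex_onto (fun T => i |: T)%SET (fun S => S :\ i)%SET)
    => [|S /andP[_ iS]]; last by rewrite finset.setD1K.
  apply: eq_big => T.
    rewrite setU11 andbT; apply/andP/andP => [[cT /eqP eT]|[/eqP <- iT]].
      have iT : i \notin T by rewrite -eT !inE eqxx.
      by move: cT; rewrite cardsU1 iT.
    by rewrite cardsU1 iT setU1K ?eqxx.
  by move=> /andP[_ /eqP ->].
rewrite (exchange_big_dep (fun T : {set 'I_r} => #|T| == k)) /= => [|i T _ /andP[]] //.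
rewrite -sumrMnl; apply: eq_bigr => T Tk; rewrite Tk sumr_const; congr (_ *+ _).
rewrite -[r in RHS]card_ord -(eqP Tk) -(cardsC T) addKn.
by apply: eq_card => i; rewrite !inE.
Qed.

Lemma logEuclid_tnth (R : realType) (d r k : nat) (rho : 'I_r -> 'M[R[i]]_d)
    (t : k.-tuple 'I_r) : sorted ltn (map val t) ->
  logEuclid (fun j : 'I_k => rho (tnth t j)) = set_logEuclid rho [set x in t]%SET.
Proof.
move=> /sorted_tuple_uniq ut.
apply: (congr1 inf); apply: eq_imagel => e _.
suff E : k%:R^-1 *: \sum_(j < k) lnmx (rho (tnth t j) + (e%:C)%:M) =
    log_mean rho [set x in t]%SET e by rewrite -E.
rewrite /log_mean cardsE (card_uniqP ut) size_tuple; apply: (congr1 (GRing.scale _)).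
rewrite -(big_tuple _ _ t xpredT (fun x => lnmx (rho x + (e%:C)%:M))) /=.
by rewrite big_uniq //; apply: eq_bigl => x; rewrite !inE.
Qed.

Lemma avg_logEuclidE (R : realType) (d r k : nat) (rho : 'I_r -> 'M[R[i]]_d) :
  avg_logEuclid rho k =
  'C(r, k)%:R^-1 * \sum_(S : {set 'I_r} | #|S| == k) set_logEuclid rho S.
Proof.
rewrite /avg_logEuclid -(sum_sorted_tuples k (set_logEuclid rho)).
by apply: (congr1 ( *%R _)); apply: eq_bigr => t; exact: logEuclid_tnth.
Qed.

Theorem mainTheorem15 (R : realType) (d r : nat) (hr : (3 <= r)%N)
    (rho : 'I_r -> 'M[R[i]]_d)
    (hrho : forall j : 'I_r, quantum_state (rho j)) :
  forall k : nat, (2 <= k)%N -> (k < r)%N ->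
    avg_logEuclid rho k.+1 <= avg_logEuclid rho k.
Proof.
move=> k k2 kr; have psd j : psdmx (rho j) by case: (hrho j).
rewrite !avg_logEuclidE.
have C0 m : (m <= r)%N -> 'C(r, m)%:R != 0 :> R.
  by move=> mr; rewrite pnatr_eq0 -lt0n bin_gt0.
have kS : k.+1%:R != 0 :> R by rewrite pnatr_eq0.
(* From (k+1) C(r,k+1) = (r-k) C(r,k). The factor r - k is the multiplicity in [sum_set_remove], and
   1/(k+1) averages over the removed index, leaving one inequality per (k+1)-set. *)
have -> : ('C(r, k)%:R^-1 : R) = 'C(r, k.+1)%:R^-1 * (k.+1%:R^-1 * (r - k)%:R).
  have /(congr1 (GRing.natmul (1 : R))) := mul_bin_left r k; rewrite !natrM => binE.
  apply: (mulfI (C0 _ (ltnW kr))); rewrite divff ?C0 1?ltnW //.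
  transitivity ((r - k)%:R * 'C(r, k)%:R / (k.+1%:R * 'C(r, k.+1)%:R) : R).
    by rewrite -binE divff // mulf_neq0 ?C0.
  by rewrite invfM; ring.
rewrite -mulrA ler_wpM2l ?invr_ge0 ?ler0n // -mulrA mulr_natl -sum_set_remove mulr_sumr.
apply: ler_sum => S /eqP Sk.
by rewrite -Sk set_logEuclid_le_mean // Sk ltnS ltnW.
Qed.
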